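(* The inequality $\varepsilon_3>0$ holds if and only if there is a constant $c$ such that for every finite-dimensional vector space $V$ over $\mathrm{GF}(3)$ and all bases $B_1,B_2,\dots,B_c$ of $V$, every element of $V$ can be written as a zero-one linear combination of the elements of the union (as multisets) of $B_1,\dots,B_c$.
   Context: A hyperplane of a vector space is a subspace of codimension $1$; an affine hyperplane is a set $H+\mathbf{v}$ with $H$ a hyperplane and $\mathbf{v}$ a vector, and $H$ is the hyperplane corresponding to it. A covering of a space is minimal (irredundant) if none of its members can be omitted. For a prime power $q$ and $n\ge 1$, $l_q(n)$ denotes the minimal number $k$ such that there is a collection of $k$ affine hyperplanes of an $n$-dimensional vector space $V$ over $\mathrm{GF}(q)$ which forms a minimal covering of $V$ and for which the intersection of the corresponding hyperplanes is trivial. The number $\varepsilon_q$ is defined by $1+\varepsilon_q=\inf_{n\ge 1} l_q(n)/n$. A zero-one linear combination of a multiset of vectors is a linear combination in which each member of the multiset (counted with multiplicity) has coefficient $0$ or $1$. *)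

(* Defs.v *)
From HB Require Import structures.
From mathcomp Require Import all_boot all_order all_algebra.
From mathcomp Require Import all_classical all_reals.

Set Implicit Arguments.
Unset Strict Implicit.
Unset Printing Implicit Defensive.

Import Order.TTheory GRing.Theory Num.Theory.
Local Open Scope classical_set_scope.
Local Open Scope ring_scope.

Definition hyperplane (F : fieldType) (V : vectType F) (H : {vspace V}) : Prop :=
  (\dim H).+1 = \dim {:V}.

Definition affine_set (F : fieldType) (V : vectType F) (H : {vspace V}) (v : V) :
    set V :=
  [set h + v | h in [set` H]].

Definition minimal_covering (T : Type) (k : nat) (A : 'I_k -> set T) : Prop :=
  \bigcup_i A i = setT /\
  forall j, \bigcup_(i in [set i | i != j]) A i <> setT.

(* A collection of k affine hyperplanes is represented as a family indexed by
   'I_k; a minimal covering family automatically has pairwise distinct members,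
   so k is the cardinality of the collection. *)
Definition hyperplane_covering (F : fieldType) (V : vectType F) (k : nat) : Prop :=
  exists (H : 'I_k -> {vspace V}) (v : 'I_k -> V),
    [/\ forall i, hyperplane (H i),
        minimal_covering (fun i => affine_set (H i) (v i)) &
        (\bigcap_(i < k) H i)%VS = 0%VS].

Lemma mem_affine_lker (F : fieldType) (V : vectType F) (f : 'Hom(V, F^o)) (v x : V) :
  affine_set (lker f) v x <-> f x = f v.
Proof.
split=> [[h /= hf <-]|fx].
  by move: hf; rewrite memv_ker => /eqP fh; rewrite linearD /= fh add0r.
exists (x - v); last by rewrite subrK.
by rewrite /= memv_ker linearB /= fx subrr.
Qed.

Lemma hyperplane_lker (F : fieldType) (V : vectType F) (f : 'Hom(V, F^o)) (v : V) :
  f v != 0 -> hyperplane (lker f).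
Proof.
move=> fv; rewrite /hyperplane -(limg_ker_dim f {:V}) capfv.
suff -> : \dim (limg f) = 1%N by rewrite addn1.
apply/eqP; rewrite eqn_leq; apply/andP; split.
  by rewrite (leq_trans (dimvS (subvf _))) // dimvf.
rewrite lt0n dimv_eq0; apply/eqP => f0.
have := memv_img f (memvf v); rewrite f0 memv0.
by apply/negP.
Qed.

(* In F^n with n > 0, the affine hyperplanes x_i = a with a != 0, together with
   the hyperplane \sum_i x_i = 0, form such a covering. *)
Lemma hyperplane_covering_ex (F : finFieldType) (n : nat) :
  (0 < n)%N -> exists k, `[< hyperplane_covering 'rV[F]_n k >].
Proof.
move=> n_gt0; pose V := 'rV[F]_n.
pose T := option ('I_n * {a : F | a != 0}).
pose g (t : T) (x : V) : F^o :=
  if t is Some (i, _) then x 0 i else \sum_i x 0 i.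
have glin t : linear (g t).
  move=> a x y; case: t => [[i b]|] /=; first by rewrite !mxE.
  rewrite scaler_sumr -big_split /=.
  by apply: eq_bigr => i _; rewrite !mxE.
pose f t : 'Hom(V, F^o) :=
  linfun (HB.pack_for {linear V -> F^o} (g t) (GRing.isLinear.Build _ _ _ _ _ (glin t))).
have fE t x : f t x = g t x by rewrite /f lfunE.
pose w (t : T) : V := if t is Some (i, a) then val a *: delta_mx 0 i else 0.
have sumd (i : 'I_n) (a : F) : \sum_j (a *: delta_mx 0 i : V) 0 j = a.
  rewrite (bigD1 i) //= big1 => [|j ji]; rewrite !mxE ?eqxx ?(negPf ji) /=.
    by rewrite mulr1 addr0.
  by rewrite mulr0.
have gw t : g t (w t) = if t is Some (_, a) then val a else 0.
  case: t => [[i a]|] /=; first by rewrite !mxE !eqxx mulr1.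
  by rewrite big1 // => i _; rewrite mxE.
have mem t x : affine_set (lker (f t)) (w t) x <-> g t x = g t (w t).
  by rewrite mem_affine_lker !fE.
exists #|{: T}|; apply/asboolP.
exists (fun i => lker (f (enum_val i))), (fun i => w (enum_val i)); split.
- move=> k; pose i0 := Ordinal n_gt0.
  pose j := if enum_val k is Some (i, _) then i else i0.
  apply: (@hyperplane_lker _ _ _ (delta_mx 0 j)).
  rewrite fE /j; case: (enum_val k) => [[i a]|] /=.
    by rewrite !mxE !eqxx oner_eq0.
  by have := sumd i0 1; rewrite scale1r => ->; rewrite oner_eq0.
- split.
    apply/seteqP; split=> // x _.
    have [t xt] : exists t : T, g t x = g t (w t).
      have [-> | x0] := eqVneq x 0.
        by exists None.
      have [i xi] : exists i, x 0 i != 0.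
        apply/existsP; apply: contraNT x0; rewrite negb_exists => /forallP x0.
        by apply/eqP/rowP => i; rewrite !mxE; apply/eqP; have := x0 i; rewrite negbK.
      by exists (Some (i, exist _ (x 0 i) xi)); rewrite gw.
    by exists (enum_rank t) => //; rewrite /= enum_rankK; apply/mem.
  move=> j cov; have : setT (w (enum_val j)) by [].
  rewrite -cov => -[i /= ij /mem].
  have : enum_val i != enum_val j by rewrite (inj_eq enum_val_inj).
  rewrite gw; case: (enum_val i) => [[r a]|]; case: (enum_val j) => [[s b]|] //=.
  + rewrite !mxE eqxx /=; have [->|_] := eqVneq r s.
      rewrite mulr1 => ne e; case/eqP: ne; congr (Some (_, _)).
      exact/val_inj/esym.
    by rewrite mulr0 => _ e; have := valP a; rewrite /= -e eqxx.
  + by rewrite mxE => _ e; have := valP a; rewrite /= -e eqxx.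
  + by rewrite sumd => _ e; have := valP b; rewrite /= e eqxx.
- apply/eqP; rewrite -subv0; apply/subvP => x xH0.
  have xH (k : 'I_#|{: T}|) : x \in lker (f (enum_val k)).
    move: xH0; rewrite memvE => /subv_bigcapP /(_ k isT).
    by rewrite -memvE.
  rewrite memv0; apply/eqP/rowP => i; rewrite mxE.
  pose t : T := Some (i, exist _ 1 (oner_neq0 F)).
  have := xH (enum_rank t); rewrite enum_rankK memv_ker fE.
  by move/eqP.
Qed.

(* l_q(n), where F = GF(q). *)
Definition lq (F : finFieldType) (n : nat) (n_gt0 : (0 < n)%N) : nat :=
  ex_minn (hyperplane_covering_ex F n_gt0).

(* epsilon_q, where F = GF(q). *)
Definition epsilon (R : realType) (F : finFieldType) : R :=
  inf [set r : R | exists (n : nat) (n_gt0 : (0 < n)%N),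
                     r = (lq F n_gt0)%:R / n%:R] - 1.

(* A multiset of vectors is given by a sequence s enumerating it; each
   occurrence has its own coefficient. *)
Definition zero_one_comb (F : fieldType) (V : vectType F) (s : seq V) (v : V) : Prop :=
  exists e : 'I_(size s) -> bool, v = \sum_(i < size s) (e i)%:R *: s`_i.

(* Main.v *)
(** A family of k functionals of rank n embeds the n-dimensional space in GF(q)^k,
    and modulo its image the k unit vectors become k vectors m_i of a space of
    dimension k - n.  For q = 3, the values avoiding a given one are a translate
    of {0, 1}, so a covering says that some vector b is not a zero-one
    combination of the m_i.

    If c bases always suffice and k > c (k - n), then by matroid union some
    subspace U contains an m_j and c disjoint bases among the m_i.  Minimality at
    j writes b as a zero-one combination modulo U, and the c bases correct the
    error; hence k <= c (k - n), which bounds k / n away from 1.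

    Conversely, if c bases do not suffice, their c d vectors give a covering.  A
    minimal subfamily S has rank at least |S| - t and at least c t members, where
    t is the codimension of the span of the vectors outside S, which contradicts
    a bound k >= (1 + epsilon) n once c is large. *)

Require Import Defs.
From HB Require Import structures.
From mathcomp Require Import all_boot all_order all_algebra.
From mathcomp Require Import all_classical all_reals.
From mathcomp Require Import zify.

Set Implicit Arguments.
Unset Strict Implicit.
Unset Printing Implicit Defensive.

Import Order.TTheory GRing.Theory Num.Theory.
Local Open Scope ring_scope.

(** * Disjoint bases by augmenting exchanges *)

Section BasisPacking.
Import mathcomp.boot.fintype mathcomp.boot.finset.
Variables (F : fieldType) (L : vectType F) (I : finType) (m : I -> L).
Implicit Types (A D R : {set I}) (x y : I) (v : L).

Let fam D := [seq m x | x <- enum D].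
Let spn D := <<fam D>>%VS.

Lemma mem_span_family D x : x \in D -> m x \in spn D.
Proof. by move=> xD; apply/memv_span/map_f; rewrite mem_enum. Qed.

Lemma span_familyS A D : A \subset D -> (spn A <= spn D)%VS.
Proof.
move=> /subsetP AD; apply/span_subvP => _ /mapP[x + ->].
by rewrite mem_enum => /AD /mem_span_family.
Qed.

Lemma span_familyU1 x D : spn (x |: D) = (<[m x]> + spn D)%VS.
Proof.
rewrite -span_cons; apply: eq_span => v; rewrite inE; apply/mapP/orP.
  move=> [y]; rewrite mem_enum !inE => /orP[/eqP-> ->|yD ->]; first by left.
  by right; apply: map_f; rewrite mem_enum.
move=> [/eqP->|/mapP[y]]; first by exists x => //; rewrite mem_enum setU11.
by rewrite mem_enum => yD ->; exists y; rewrite // mem_enum setU1r.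
Qed.

Lemma free_familyU1 x D : x \notin D ->
  free (fam (x |: D)) = (m x \notin spn D) && free (fam D).
Proof.
move=> xD; rewrite -free_cons; apply/perm_free/(@perm_map _ _ m _ (x :: enum D)).
apply: uniq_perm; rewrite /= ?enum_uniq ?mem_enum ?xD //.
by move=> y; rewrite inE !mem_enum in_setU1.
Qed.

Lemma free_familyD1 x D : free (fam D) -> x \in D ->
  (m x \notin spn (D :\ x)) && free (fam (D :\ x)).
Proof.
by move=> freeD xD; rewrite -free_familyU1 ?setD1K ?inE ?eqxx.
Qed.

Lemma free_familyS A D : A \subset D -> free (fam D) -> free (fam A).
Proof.
move=> /subsetP AD; have pD : perm_eq (enum D) (enum A ++ enum (D :\: A)).
  apply: uniq_perm; first exact: enum_uniq.
    rewrite cat_uniq !enum_uniq andbT; apply/hasPn => x.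
    by rewrite !mem_enum !inE => /andP[].
  move=> x; rewrite mem_cat !mem_enum !inE.
  by have [/AD ->|] := boolP (x \in A).
by rewrite (perm_free (perm_map m pD)) map_cat => /catl_free.
Qed.

Lemma dim_span_family D : free (fam D) -> \dim (spn D) = #|D|.
Proof. by move/eqP; rewrite size_map -cardE. Qed.

(** A minimal [A] inside [D] whose span contains [v] is the support of [v] in the free family; the
    hypothesis says that the coefficient of [v] vanishes at each [y] outside [R]. *)
Lemma span_circuit D R v : free (fam D) -> v \in spn D ->
  (forall y, y \in D -> y \notin R -> v \in spn (D :\ y)) ->
  v \in spn (D :&: R).
Proof.
move=> freeD vD vDy.
have [A minA AD] := @minset_exists _ (fun A => v \in spn A) D vD.
have /minsetP[vA Amin] := minA.
suff AR : A \subset D :&: R by apply: subvP (span_familyS AR) _ vA.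
rewrite subsetI AD; apply/subsetP => y yA; apply/negPn/negP => yR.
have yD := subsetP AD y yA.
have /andP[myD _] := free_familyD1 freeD yD.
suff vAy : v \in spn (A :\ y).
  by have /setP/(_ y) := Amin _ vAy (subsetDl _ _); rewrite !inE eqxx yA.
move: vA; rewrite -{1}(setD1K yA) span_familyU1.
move=> /memv_addP[_ /vlineP[a ->] [w wA vE]].
have wD : w \in spn (D :\ y) by apply: subvP wA; apply/span_familyS/setSD.
have : a *: m y \in spn (D :\ y).
  by rewrite -(addrK w (a *: m y)) -vE memvB // vDy.
have [a0|a0] := eqVneq a 0; first by rewrite vE a0 scale0r add0r.
by move/(memvZ a^-1); rewrite scalerK // (negPf myD).
Qed.

Variable c : nat.
Implicit Types (phi : {ffun I -> option 'I_c}) (i : 'I_c).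

Let cls phi i := [set x | phi x == Some i].
Let valid phi := [forall i, free (fam (cls phi i))].
Let covered phi := [set x | phi x != None].
Let recolour phi x o := [ffun z => if z == x then o else phi z].


Lemma mem_cls phi i x : (x \in cls phi i) = (phi x == Some i).
Proof. by rewrite inE. Qed.

Lemma card_covered phi : valid phi -> (#|covered phi| <= c * \dim {:L})%N.
Proof.
move=> /forallP phiV.
have -> : covered phi = (\bigcup_i cls phi i)%SET.
  apply/setP => x; rewrite inE; apply/idP/bigcupP.
    by case E: (phi x) => [i|] // _; exists i; rewrite ?inE ?E.
  by move=> [i _]; rewrite inE => /eqP->.
apply: leq_trans (_ : \sum_(i < c) #|cls phi i| <= _)%N.
  elim/big_rec2: _ => [|i n A _ IH]; first by rewrite cards0.
  by rewrite (leq_trans (leq_card_setU _ _)) // leq_add2l.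
rewrite -[X in (_ <= X * _)%N]card_ord -sum_nat_const.
by apply: leq_sum => i _; rewrite -dim_span_family ?dimvS ?subvf.
Qed.

Variables (phi0 : {ffun I -> option 'I_c}) (e0 : I).
Hypotheses (valid0 : valid phi0) (fresh0 : phi0 e0 = None).
Hypothesis max0 :
  forall phi, valid phi -> (#|covered phi| <= #|covered phi0|)%N.

(* A state is a maximum packing phi together with an uncovered index e; a move
   exchanges e with an element y of its fundamental circuit in one class, which
   leaves y uncovered. *)
Inductive reachable : {ffun I -> option 'I_c} -> I -> Prop :=
| reachable_start : reachable phi0 e0
| reachable_swap phi e y i : reachable phi e -> phi y = Some i ->
    m e \notin spn (cls phi i :\ y) ->
    reachable (recolour (recolour phi y None) e (Some i)) y.

Let R : {set I} := [set y | `[< exists phi, reachable phi y >]].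

Lemma mem_reached phi y : reachable phi y -> y \in R.
Proof. by move=> ry; rewrite inE; apply/asboolP; exists phi. Qed.

Lemma cls_recolour_None phi y i :
  cls (recolour phi y None) i = cls phi i :\ y.
Proof. by apply/setP => x; rewrite !inE ffunE; case: (x == y). Qed.

Lemma cls_recolour_Some phi e i j : phi e = None ->
  cls (recolour phi e (Some i)) j =
    if j == i then e |: cls phi j else cls phi j.
Proof.
move=> fe; have [->|ji] := eqVneq j i; apply/setP => x; rewrite !inE ffunE.
  by case: (x == e); rewrite ?eqxx.
by case: (eqVneq x e) => // ->; rewrite fe; apply/eqP => -[E]; rewrite E eqxx in ji.
Qed.

(** Otherwise adding [e] to class [i] would give a larger packing. *)
Lemma uncovered_mem_span phi e i : valid phi -> phi e = None ->
  #|covered phi| = #|covered phi0| -> m e \in spn (cls phi i).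
Proof.
move=> phiV fe cphi; apply/negPn/negP => me.
pose psi := recolour phi e (Some i).
have psiV : valid psi.
  apply/forallP => j; rewrite cls_recolour_Some //.
  have [->|_] := eqVneq; last exact: (forallP phiV).
  by rewrite free_familyU1 ?me ?(forallP phiV) // inE fe.
have := max0 psiV; rewrite -cphi.
have -> : covered psi = e |: covered phi.
  by apply/setP => x; rewrite !inE ffunE; case: (x == e).
by rewrite cardsU1 inE fe eqxx ltnn.
Qed.

(** Each [y] of class [i] occurring in the expansion of [m e] can be swapped with [e], hence is
    itself reached. *)
Lemma reachable_circuit phi e i : reachable phi e -> valid phi ->
  m e \in spn (cls phi i) -> m e \in spn (cls phi i :&: R).
Proof.
move=> re /forallP phiV me; apply: span_circuit => // y.
rewrite inE => /eqP fy yR; apply/negPn/negP => mey; case/negP: yR.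
exact: mem_reached (reachable_swap re fy mey).
Qed.

(** The last clause carries the argument: a swap changes one class, and there it only trades [y] for
    [e], both in [R]. *)
Lemma reachable_invariant phi e : reachable phi e ->
  [/\ valid phi, phi e = None, #|covered phi| = #|covered phi0| &
      forall i, spn (cls phi i :&: R) = spn (cls phi0 i :&: R)].
Proof.
elim=> [|{}phi {}e y i re [phiV fe cphi inv] fy mey]; first by split.
have me := uncovered_mem_span i phiV fe cphi.
have yC : y \in cls phi i by rewrite inE fy.
have ey : e != y by apply: contraPneq fy => <-; rewrite fe.
have fe' : recolour phi y None e = None by rewrite ffunE (negPf ey).
have yR : y \in R by apply: mem_reached (reachable_swap re fy mey).
have eR : e \in R by apply: mem_reached re.
have clsj j : cls (recolour (recolour phi y None) e (Some i)) j =
    if j == i then e |: (cls phi i :\ y) else cls phi j.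
  rewrite cls_recolour_Some // cls_recolour_None.
  have [->|ji] := eqVneq j i; first by [].
  apply/setDidPl; rewrite disjoint_sym disjoints1 inE fy.
  by apply/eqP => -[ij]; rewrite ij eqxx in ji.
have eC : e \notin cls phi i :\ y by rewrite !inE fe andbF.
have freej j : free (fam (cls (recolour (recolour phi y None) e (Some i)) j)).
  rewrite clsj; have [_|_] := eqVneq; last exact: (forallP phiV).
  rewrite free_familyU1 // mey /=.
  by have /andP[] := free_familyD1 (forallP phiV i) yC.
split; first exact/forallP.
- by rewrite !ffunE eq_sym (negPf ey) eqxx.
- rewrite -cphi; set psi := recolour _ _ _.
  have -> : covered psi = e |: (covered phi :\ y).
    apply/setP => x; rewrite !inE !ffunE.
    by case: (x == e); case: (x == y).
  rewrite cardsU1 !inE fe andbF /= (cardsD1 y (covered phi)) inE fy.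
  by [].
- move=> j; rewrite -inv; move: (freej j); rewrite clsj.
  have [->{j} freeN|//] := eqVneq.
  (* The new span lies in the old one by [reachable_circuit], and both families are free with
     equally many members. *)
  apply/eqP; rewrite eqEdim.
  have freeI A : free (fam A) -> free (fam (A :&: R)).
    exact/free_familyS/subsetIl.
  have eRI : [set e] :&: R = [set e] by apply/setIidPl; rewrite sub1set.
  rewrite !dim_span_family ?freeI ?(forallP phiV) //; apply/andP; split.
    rewrite setIUl eRI span_familyU1 subv_add.
    rewrite -memvE reachable_circuit //=.
    by apply/span_familyS/setSI/subsetDl.
  rewrite setIUl eRI setIDAC cardsU1 (cardsD1 y (_ :&: R)).
  by rewrite in_setD1 !in_setI !mem_cls fe fy eqxx yR andbF.
Qed.

(** Every reached [y] is uncovered in some reachable packing, so [m y] lies in the span of the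
    [R]-part of each class there; by invariance this is the span for [phi0]. *)
Lemma packing_reached i :
  basis_of <<[seq m x | x in R]>> (fam (cls phi0 i :&: R)).
Proof.
rewrite basisEfree (free_familyS (subsetIl _ _) (forallP valid0 i)) /=.
have spR : spn (cls phi0 i :&: R) = spn R.
  apply/eqP; rewrite eqEsubv span_familyS ?subsetIr //=.
  apply/span_subvP => _ /mapP[y + ->]; rewrite mem_enum inE => /asboolP[phi ry].
  have [phiV fy cphi <-] := reachable_invariant ry.
  exact: reachable_circuit (uncovered_mem_span i phiV fy cphi).
have -> : <<[seq m x | x in R]>>%VS = spn (cls phi0 i :&: R) by rewrite spR.
rewrite subvv dim_span_family ?size_map -?cardE ?leqnn //.
exact: free_familyS (subsetIl _ _) (forallP valid0 i).
Qed.
End BasisPacking.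

(* A weak form of the matroid union theorem. *)
Lemma basis_packing (F : fieldType) (L : vectType F) (I : finType) (m : I -> L)
    (c : nat) : (c * \dim {:L} < #|I|)%N ->
  exists (phi : I -> option 'I_c) (U : {vspace L}) (e : I), m e \in U /\
    forall i, basis_of U [seq m x | x <- enum [pred x | phi x == Some i]].
Proof.
move=> ltcI.
pose good (phi : {ffun I -> option 'I_c}) :=
  [forall i, free [seq m x | x <- enum [set x | phi x == Some i]%SET]].
pose cov (phi : {ffun I -> option 'I_c}) := #|[set x | phi x != None]%SET|.
have good0 : good [ffun=> None].
  apply/forallP => i; rewrite (_ : finset _ = finset.set0) ?enum_set0 ?nil_free //.
  by apply/finset.setP => x; rewrite !inE ffunE.
case: (arg_maxnP cov good0) => phi phiV phimax.
(* A packing covers at most [c * \dim {:L}] indices, so some index stays uncovered and can start the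
   exchanges. *)
case: (pickP (fun x => phi x == None)) => [e /eqP phie|phi_cov]; last first.
  have := card_covered phiV; rewrite leqNgt => /negP[].
  rewrite (leq_trans ltcI) // -cardsT subset_leq_card //.
  by apply/fintype.subsetP => x _; rewrite inE phi_cov.
have := packing_reached phiV phie phimax; set R := finset _ => basisR.
exists (fun x => if x \in R then phi x else None), <<[seq m x | x in R]>>%VS, e.
split.
  apply/memv_span/map_f; rewrite mem_enum inE; apply/asboolP; exists phi.
  exact: reachable_start.
move=> i; rewrite (eq_enum (_ : _ =i ([set x | phi x == Some i] :&: R)%SET)).
  exact: basisR.
move=> x; rewrite finset.in_setI [LHS]/= [x \in finset (fun x => _ == _)]inE.
by rewrite inE; case: (x \in R); rewrite ?andbT ?andbF.
Qed.

(** * Coverings by affine hyperplanes in matrix form *)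

(* The row x *m A lists the values at x of the k functionals that define the
   hyperplanes; row freeness says that the hyperplanes meet in 0. *)
Definition covering_matrix (F : fieldType) n k (A : 'M[F]_(n, k)) (a : 'rV_k) :=
  [/\ row_free A,
      forall x : 'rV_n, exists i, (x *m A) 0 i = a 0 i &
      forall j, exists x : 'rV_n, forall i, i != j -> (x *m A) 0 i != a 0 i].

Lemma hyperplane_functional (F : fieldType) (V : vectType F) (H : {vspace V}) :
  hyperplane H -> exists f : 'Hom(V, F^o), H = lker f.
Proof.
move=> hypH; have dimC : \dim H^C = 1%N.
  by rewrite dimv_compl -hypH subSnn.
pose w := vpick H^C%VS; have CE : (H^C = <[w]>)%VS.
  apply/esym/eqP; rewrite eqEdim -memvE memv_pick dimC dim_vline /=.
  by rewrite vpick0 -dimv_eq0 dimC.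
(* The functional is the coordinate along [w] of the projection onto the complementary line with
   kernel [H]. *)
pose f := (linfun (coord [tuple w] ord0 : V -> F^o) \o daddv_pi H^C H)%VF.
have HC0 : (H^C :&: H = 0)%VS by rewrite capvC capv_compl.
have fE v : f v *: w = daddv_pi H^C H v.
  have : daddv_pi H^C H v \in <<[tuple w]>>%VS by rewrite span_seq1 -CE memv_pi.
  by move/coord_span => ->; rewrite big_ord1 comp_lfunE lfunE.
exists f; apply/vspaceP => v; rewrite memv_ker.
have w0 : w != 0 by rewrite vpick0 -dimv_eq0 dimC.
have addE : daddv_pi H^C H v + daddv_pi H H^C v = v.
  by apply: daddv_pi_add; rewrite // addvC addv_complf memvf.
apply/idP/eqP => [vH|fv0].
  apply/eqP; suff : f v *: w == 0 by rewrite scaler_eq0 (negPf w0) orbF.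
  rewrite fE -memv0 -HC0 memv_cap memv_pi /=.
  by rewrite -[X in X \in _](addrK (daddv_pi H H^C v)) addE memvB ?memv_pi.
by rewrite -addE -fE fv0 scale0r add0r memv_pi.
Qed.

Section Coverings.
Variables (F : fieldType) (n k : nat).

Lemma hyperplane_covering_matrix : hyperplane_covering 'rV[F]_n k ->
  exists (A : 'M[F]_(n, k)) (a : 'rV_k), covering_matrix A a.
Proof.
move=> [H [v [hypH [cov mincov] capH]]].
have [f Hf] := boolp.choice (fun i => hyperplane_functional (hypH i)).
pose A : 'M[F]_(n, k) := \matrix_(r, i) (f i (delta_mx 0 r) : F).
have AE x i : (x *m A) 0 i = f i x.
  rewrite mxE [in RHS](row_sum_delta x) linear_sum; apply: eq_bigr => r _.
  by rewrite linearZ mxE.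
have mem x i : affine_set (H i) (v i) x <-> (x *m A) 0 i = (v i *m A) 0 i.
  by rewrite !AE Hf; exact: mem_affine_lker.
exists A, (\row_i (v i *m A) 0 i); split.
- apply/inj_row_free => x xA0; apply/eqP; rewrite -memv0 -capH.
  rewrite memvE; apply/subv_bigcapP => i _; rewrite -memvE Hf memv_ker -AE xA0.
  by rewrite mxE.
- move=> x; have : (\bigcup_i affine_set (H i) (v i))%classic x by rewrite cov.
  by move=> [i _ /mem e]; exists i; rewrite [RHS]mxE.
- move=> j; apply/not_existsP => nx; apply: (mincov j); apply/seteqP.
  split=> // x _; apply: contrapT => ncov; apply: (nx x) => i ij.
  apply/eqP; rewrite [RHS]mxE => e; apply: ncov; exists i => //.
  exact/mem.
Qed.

Lemma matrix_hyperplane_covering (A : 'M[F]_(n, k)) (a : 'rV_k) :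
  (0 < n)%N -> covering_matrix A a -> hyperplane_covering 'rV[F]_n k.
Proof.
move=> n_gt0 [freeA cov mincov].
have Aj j : exists r, A r j != 0.
  apply/not_existsP => Aj0.
  have xj0 (x : 'rV_n) : (x *m A) 0 j = 0.
    rewrite mxE big1 // => r _; apply/eqP; rewrite mulf_eq0.
    by move: (Aj0 r) => /negP; rewrite negbK => ->; rewrite orbT.
  have [aj0|aj0] := eqVneq (a 0 j) 0; last first.
    have [x xP] := mincov j; have [i xi] := cov x.
    have [ij|ij] := eqVneq i j; last by have := xP i ij; rewrite xi eqxx.
    by move: aj0; rewrite -ij -xi ij xj0 eqxx.
  have single i : i = j.
    apply/eqP; apply: contrapT => /negP; rewrite eq_sym => ij.
    have [x /(_ j ij)] := mincov i.
    by rewrite xj0 aj0 eqxx.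
  have A0 : A = 0.
    apply/matrixP => r i; rewrite (single i) mxE.
    by move: (Aj0 r) => /negP; rewrite negbK => /eqP.
  by move: freeA n_gt0; rewrite /row_free A0 mxrank0 => /eqP <-.
have /boolp.choice[v vP] i : exists w : 'rV[F]_n, (w *m A) 0 i = a 0 i.
  have [r rP] := Aj i.
  exists ((a 0 i / A r i) *: delta_mx 0 r).
  by rewrite -scalemxAl -rowE !mxE divfK.
have lin i : linear (fun x : 'rV[F]_n => (x *m A) 0 i : F^o).
  by move=> b x y; rewrite mulmxDl -scalemxAl !mxE.
pose f i : 'Hom('rV[F]_n, F^o) := linfun (HB.pack_for {linear 'rV[F]_n -> F^o}
  (fun x : 'rV[F]_n => (x *m A) 0 i : F^o) (GRing.isLinear.Build _ _ _ _ _ (lin i))).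
have fE i x : f i x = (x *m A) 0 i by rewrite /f lfunE.
have mem x i : affine_set (lker (f i)) (v i) x <-> (x *m A) 0 i = a 0 i.
  by rewrite mem_affine_lker !fE vP.
exists (fun i => lker (f i)), v; split.
- move=> i; have [r rP] := Aj i.
  by apply: (@hyperplane_lker _ _ _ (delta_mx 0 r)); rewrite fE -rowE mxE.
- split.
    apply/seteqP; split=> // x _; have [i /mem xi] := cov x.
    by exists i.
  move=> j /seteqP[_ full]; have [x xP] := mincov j.
  have [i /= ij /mem e] := full x I.
  by have := xP i ij; rewrite e eqxx.
- apply/eqP; rewrite -subv0; apply/subvP => x; rewrite memvE.
  move=> /subv_bigcapP xker; rewrite memv0 -(mulmx_free_eq0 x freeA).
  apply/eqP/rowP => i; rewrite [RHS]mxE -fE.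
  by have := xker i isT; rewrite -memvE memv_ker => /eqP.
Qed.
End Coverings.

(** * Manipulating zero-one combinations *)

Lemma zero_one_combP (F : fieldType) (V : vectType F) (s : seq V) (v : V) :
  zero_one_comb s v <->
  exists e : nat -> bool, v = \sum_(i < size s) (e i)%:R *: s`_i.
Proof.
split=> [[e ->]|[e ->]]; last by exists (fun i => e i).
exists (fun i => if insub i is Some j then e j else false).
by apply: eq_bigr => i _; rewrite valK.
Qed.

Lemma zero_one_comb_map (F : fieldType) (V W : vectType F)
    (f : {linear V -> W}) (s : seq V) (v : V) :
  zero_one_comb s v -> zero_one_comb [seq f x | x <- s] (f v).
Proof.
move=> /zero_one_combP[e ->]; apply/zero_one_combP; exists e.
rewrite linear_sum size_map; apply: eq_bigr => i _.
by rewrite linearZ (nth_map 0).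
Qed.

Lemma zero_one_comb_uniq (F : fieldType) (V : vectType F) (T : eqType)
    (m : T -> V) (t : seq T) (v : V) : uniq t ->
  zero_one_comb [seq m x | x <- t] v <->
  exists e : T -> bool, v = \sum_(x <- t) (e x)%:R *: m x.
Proof.
case: t => [|x0 t'] /=; last set t := x0 :: t'.
  move=> _; split=> [[e ->]|[e ->]]; rewrite ?big_ord0 ?big_nil.
    by exists (fun=> false); rewrite big_nil.
  by exists (fun=> false); rewrite big_ord0.
rewrite -[_ && _]/(uniq t) -/[seq m x | x <- t] => ut.
have sumE (e : nat -> bool) :
    \sum_(i < size [seq m x | x <- t]) (e i)%:R *: [seq m x | x <- t]`_i
    = \sum_(x <- t) (e (index x t))%:R *: m x.
  rewrite (big_nth x0) -(size_map m t) big_mkord; apply: eq_bigr => i _.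
  have it : (i < size t)%N by rewrite -(size_map m).
  by rewrite (nth_map x0) ?index_uniq.
split=> [/zero_one_combP[e ->]|[e ->]].
  by exists (fun x => e (index x t)).
apply/zero_one_combP; exists (fun i => e (nth x0 t i)).
rewrite (sumE (fun i => e (nth x0 t i))) !big_seq; apply: eq_bigr => x xt.
by rewrite nth_index.
Qed.

Lemma zero_one_comb_flatten (F : fieldType) (V : vectType F) (I : finType)
    (J : eqType) (m : I -> J -> V) (t : I -> seq J) (v : V) :
  (forall i, uniq (t i)) ->
  zero_one_comb (flatten [seq [seq m i x | x <- t i] | i <- enum I]) v <->
  exists e : I -> J -> bool, v = \sum_i \sum_(x <- t i) (e i x)%:R *: m i x.
Proof.
move=> ut; pose p := [seq (i, x) | i <- enum I, x <- t i].
have up : uniq p.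
  apply: allpairs_uniq_dep => [|i _|]; [exact: enum_uniq|exact: ut|].
  by move=> [i x] [j y] _ _ /= [-> ->].
have -> : flatten [seq [seq m i x | x <- t i] | i <- enum I] =
    [seq m q.1 q.2 | q <- p].
  by rewrite map_allpairs.
have sumE (e : I * J -> bool) : \sum_(q <- p) (e q)%:R *: m q.1 q.2 =
    \sum_i \sum_(x <- t i) (e (i, x))%:R *: m i x.
  by rewrite big_allpairs_dep big_enum.
rewrite (zero_one_comb_uniq _ _ up); split=> [[e ->]|[e ->]].
  by exists (fun i x => e (i, x)).
by exists (fun q => e q.1 q.2); rewrite sumE.
Qed.

(** * From additive bases to a bound on coverings *)

Lemma F3_neq0 (x : 'F_3) : x != 0 -> exists b : bool, x = 1 + b%:R.
Proof.
case: x => [[|[|[|i]]] xP] // _; first by exists false; apply/val_inj.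
by exists true; apply/val_inj.
Qed.

Lemma F3_1D_bool_neq0 (b : bool) : 1 + b%:R != 0 :> 'F_3.
Proof. by case: b. Qed.

Definition additive_basis_bound (c : nat) : Prop :=
  forall (V : vectType 'F_3) (B : 'I_c -> seq V),
    (forall i, basis_of {:V} (B i)) ->
    forall v : V, zero_one_comb (flatten [seq B i | i <- enum 'I_c]) v.

(** The packing yields bases of a subspace only; the bound is applied to [U] as a space of its own,
    and the combination is carried back by the inclusion. *)
Lemma additive_basis_bound_sub (c : nat) (V : vectType 'F_3) (U : {vspace V})
    (B : 'I_c -> seq V) (v : V) :
  additive_basis_bound c -> (forall i, basis_of U (B i)) -> v \in U ->
  zero_one_comb (flatten [seq B i | i <- enum 'I_c]) v.
Proof.
move=> bound basisB vU.
pose B' i := [seq vsproj U x | x <- B i].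
have basisB' i : basis_of {:subvs_of U} (B' i).
  have BU := span_basis (basisB i).
  rewrite basisEdim; apply/andP; split.
    apply/subvP => u _; have := limg_span (linfun (vsproj U)) (B i).
    rewrite BU (eq_map (lfunE _)) => <-.
    by rewrite -[u]vsvalK -[vsproj _ _]lfunE memv_img ?subvsP.
  rewrite size_map; have /andP[_ /eqP fB] := basisB i.
  by rewrite -fB BU dimvf.
have -> : flatten [seq B i | i <- enum 'I_c] =
    [seq vsval x | x <- flatten [seq B' i | i <- enum 'I_c]].
  rewrite map_flatten -map_comp; congr flatten; apply: eq_map => i /=.
  rewrite -map_comp map_id_in // => x xB /=.
  by rewrite vsprojK // (basis_mem (basisB i)).
by rewrite -(vsprojK vU); apply: zero_one_comb_map; exact: bound.
Qed.

(* Shifting by -1 turns the nowhere-zero vectors of GF(3)^k into the zero-one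
   vectors, so a covering matrix says that the target b below is not a zero-one
   combination of the rows m_i, while minimality at j puts b in such a
   combination modulo m_j. *)
Lemma covering_matrix_size (c n k : nat) (A : 'M['F_3]_(n, k)) (a : 'rV_k) :
  additive_basis_bound c -> covering_matrix A a -> (k <= c * (k - n))%N.
Proof.
move=> bound [freeA cov mincov]; rewrite leqNgt; apply/negP => ltk.
(* Right multiplication by [M] is the quotient map of GF(3)^k by the row space of [A], onto
   dimension [k - n]. *)
pose M := col_base (cokermx A).
have kerM (z : 'rV_k) : z *m M = 0 -> exists x, x *m A = z.
  move=> zM; have : (z <= A)%MS.
    by rewrite submxE -(mulmx_base (cokermx A)) mulmxA zM mul0mx.
  by move/submxP => [x ->]; exists x.
have AM : A *m M = 0.
  apply/eqP; rewrite -(mulmx_free_eq0 _ (row_base_free (cokermx A))).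
  by rewrite -mulmxA mulmx_base mulmx_coker.
pose m (i : 'I_k) := row i M.
pose b : 'rV['F_3]_k := - (const_mx 1 + a).
have combE (y : 'rV_k) : y *m M = \sum_i y 0 i *: m i by rewrite mulmx_sum_row.
have notb (e : 'I_k -> bool) : b *m M <> \sum_i (e i)%:R *: m i.
  pose y : 'rV['F_3]_k := \row_i (e i)%:R; move=> eb.
  have [x xA] : exists x, x *m A = y - b.
    apply: kerM; rewrite mulmxBl eb combE; apply/eqP; rewrite subr_eq0; apply/eqP.
    by apply: eq_bigr => i _; rewrite mxE.
  have [i] := cov x; rewrite xA !mxE opprK => /eqP.
  by rewrite addrA -subr_eq0 addrK addrC (negPf (F3_1D_bool_neq0 _)).
have ltI : (c * \dim {:'rV['F_3]_(\rank (cokermx A))} < #|'I_k|)%N.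
  rewrite card_ord dimvf /dim /= mul1n mxrank_coker.
  by move/eqP: freeA => ->.
have [phi [U [j [mjU basisU]]]] := basis_packing m ltI.
(* The point [x] misses every hyperplane except possibly the [j]-th, so only the entry of [y] at [j]
   may fail to be zero or one. *)
have [x xP] := mincov j; pose y := x *m A + b.
have yb : y *m M = b *m M by rewrite mulmxDl -mulmxA AM mulmx0 add0r.
have y01 i : i != j -> y 0 i = (y 0 i == 1)%:R.
  move=> /xP xi; have /F3_neq0[e xie] : (x *m A) 0 i - a 0 i != 0.
    by rewrite subr_eq0.
  have -> : y 0 i = e%:R.
    have bE : b 0 i = - (1 + a 0 i) by rewrite !mxE.
    by rewrite mxE bE opprD addrCA xie addKr.
  by case: (e).
(* Coefficients at [out] indices are kept. All other terms, including the bad one at [j], sum to an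
   element of [U], which the [c] bases rewrite. *)
pose out i := (phi i == None) && (i != j).
have inU : \sum_(i | ~~ out i) y 0 i *: m i \in U.
  apply: memv_suml => i; rewrite negb_and negbK => /orP[|/eqP->]; last exact: memvZ.
  case E: (phi i) => [l|] // _; apply/memvZ/(basis_mem (basisU l))/map_f.
  by rewrite mem_enum inE E.
have := additive_basis_bound_sub bound basisU inU.
move=> /(zero_one_comb_flatten (fun=> m) _ (fun i => enum_uniq _)) [e eE].
apply: (notb (fun i => if phi i is Some l then e l i else out i && (y 0 i == 1))).
rewrite -yb combE (bigID out) /= eE.
rewrite (eq_bigr (fun l => \sum_i if phi i == Some l then (e l i)%:R *: m i else 0)).
  rewrite exchange_big [X in X + _]big_mkcond -big_split; apply: eq_bigr => i _ /=.
  rewrite /out; case: (phi i) => [l|] /=.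
    rewrite add0r (bigD1 l) //= eqxx big1 ?addr0 // => l' ll'.
    by case: eqP => // -[E]; rewrite E eqxx in ll'.
  rewrite big1 ?addr0 //; have [_|/y01 {1}->//] := eqVneq i j.
  by rewrite scale0r.
by move=> l _; rewrite big_enum big_mkcond.
Qed.

(** * From families of bases to minimal coverings *)

Lemma rank_rowsub_unit (F : fieldType) (k d : nat) (f : 'I_k -> 'I_d)
    (W : 'M[F]_d) : injective f -> W \in unitmx -> \rank (rowsub f W) = k.
Proof.
move=> injf unitW; rewrite -[W]mul1mx -mul_rowsub_mx mxrankMfree ?row_free_unit //.
apply/eqP/row_freeP; exists (rowsub f 1%:M)^T.
apply/matrixP => i j; rewrite !mxE (bigD1 (f i)) //= !mxE eqxx mul1r.
rewrite big1 => [|l li]; last by rewrite !mxE eq_sym (negPf li) mul0r.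
by rewrite addr0 (inj_eq injf) eq_sym.
Qed.

Section BasesToCovering.
Import mathcomp.boot.fintype mathcomp.boot.finset.
Variables (F : fieldType) (c d : nat) (W : 'I_c -> 'M[F]_d).
Hypothesis unitW : forall i, W i \in unitmx.
Variables (b : 'rV[F]_d) (u : F).

Let P := ('I_c * 'I_d)%type.
Let r (p : P) : 'rV_d := row p.2 (W p.1).
Let rows (S : {set P}) : 'M[F]_(#|S|, d) := \matrix_(i < #|S|) r (enum_val i).
Let comb (y : P -> F) : 'rV_d := \sum_p y p *: r p.

Let extend (S : {set P}) (z : 'rV[F]_#|S|) (p : P) : F :=
  \sum_(i | enum_val i == p) z 0 i.

Lemma extend_enum_val (S : {set P}) (z : 'rV_#|S|) i : extend z (enum_val i) = z 0 i.
Proof. by apply: big_pred1 => j; rewrite (inj_eq enum_val_inj). Qed.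

Lemma extend_notin (S : {set P}) (z : 'rV_#|S|) p : p \notin S -> extend z p = 0.
Proof.
by move=> pS; apply: big_pred0 => i; apply: contraNF pS => /eqP <-; exact: enum_valP.
Qed.

Lemma comb_extend (S : {set P}) (z : 'rV_#|S|) : comb (extend z) = z *m rows S.
Proof.
rewrite /comb (bigID (mem S)) /= [X in _ + X]big1 => [|p pS]; last first.
  by rewrite extend_notin ?scale0r.
rewrite addr0 big_enum_val mulmx_sum_row; apply: eq_bigr => i _.
by rewrite extend_enum_val rowK.
Qed.

Lemma comb_split (S : {set P}) y : comb y =
  (\row_i y (enum_val i)) *m rows S + (\row_i y (enum_val i)) *m rows (~: S).
Proof.
rewrite /comb (bigID (mem S)) /=; congr (_ + _).
  by rewrite big_enum_val mulmx_sum_row; apply: eq_bigr => i _; rewrite rowK mxE.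
rewrite (eq_bigl (mem (~: S))) => [|p]; last by rewrite /= inE.
by rewrite big_enum_val mulmx_sum_row; apply: eq_bigr => i _; rewrite rowK mxE.
Qed.

(** Members of [S] in one block are distinct rows of an invertible matrix, hence independent; there
    are [c] blocks. *)
Lemma card_rows_le (S : {set P}) : (#|S| <= c * \rank (rows S))%N.
Proof.
have cardS : #|S| = (\sum_(i < c) #|[set j | (i, j) \in S]|)%N.
  rewrite -sum1_card (eq_bigr (fun i => \sum_(j | (i, j) \in S) 1)%N); last first.
    by move=> i _; rewrite -sum1_card; apply: eq_bigl => j; rewrite inE.
  by rewrite pair_big_dep /=; apply: eq_bigl => -[].
rewrite [X in (X <= _)%N]cardS.
rewrite -[X in (_ <= X * _)%N]card_ord -sum_nat_const; apply: leq_sum => i _.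
set J := finset _.
rewrite -(rank_rowsub_unit (@enum_val_inj _ (mem J)) (unitW i)); apply: mxrankS.
apply/row_subP => l; have := enum_valP l; rewrite inE => lS.
rewrite row_rowsub -[row _ _]/(r (i, enum_val l)).
rewrite -(enum_rankK_in lS lS) -[r _](rowK (fun i => r (enum_val i))).
exact: row_sub.
Qed.

(** The hyperplanes [y p = u] with [p] in [S] cover the affine space of all representations of
    [b]. *)
Let hits (S : {set P}) : Prop :=
  forall y, comb y = b -> exists2 p, p \in S & y p = u.

Variables (y0 : P -> F) (S : {set P}).
Hypotheses (comb_y0 : comb y0 = b) (hitsS : hits S).
Hypothesis minS : forall p, p \in S -> ~ hits (S :\ p).

(** Its kernel consists of the restrictions to [S] of linear relations among all the rows. *)
Let N : 'M[F]_(#|S|, d) := rows S *m cokermx (rows (~: S)).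

(** Coefficients outside [S] are free to absorb the change [z]. With [comb_sub_kermx], the
    restrictions to [S] of representations of [b] are exactly the coset of [y0] modulo the kernel of
    [N]. *)
Lemma sub_kermx_ext (z : 'rV_#|S|) : (z <= kermx N)%MS ->
  exists2 y, comb y = b & forall i, y (enum_val i) = y0 (enum_val i) + z 0 i.
Proof.
rewrite sub_kermx mulmxA -submxE => /submxP[g zE].
exists (fun p => y0 p + extend z p - extend g p) => [|i]; last first.
  rewrite extend_enum_val [extend g _]extend_notin ?subr0 //.
  by rewrite inE negbK enum_valP.
rewrite -[RHS]addr0 -(subrr (g *m rows (~: S))) -{1}zE -!comb_extend -comb_y0.
rewrite addrA /comb -!(sumrN, big_split) /=.
by apply: eq_bigr => p _; rewrite !scalerDl scaleNr.
Qed.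

Lemma comb_sub_kermx y : comb y = b ->
  (\row_i (y (enum_val i) - y0 (enum_val i)) <= kermx N)%MS.
Proof.
move=> yb; rewrite sub_kermx mulmxA -submxE.
have /eqP : comb (fun p => y p - y0 p) = 0.
  rewrite -(subrr b) -{1}yb -comb_y0 /comb -sumrN -big_split /=.
  by apply: eq_bigr => p _; rewrite scalerDl scaleNr.
rewrite (comb_split S) addr_eq0 => /eqP ->.
by rewrite -mulNmx submxMl.
Qed.

(** Translating the coset by [y0] turns [y p = u] into [z p = u - y0 p]; [hitsS] gives the covering
    and [minS] its irredundancy. *)
Lemma kermx_covering_matrix :
  covering_matrix (row_base (kermx N)) (\row_i (u - y0 (enum_val i))).
Proof.
split=> [|x|j]; first exact: row_base_free.
  have /sub_kermx_ext[y yb yE] : (x *m row_base (kermx N) <= kermx N)%MS.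
    by rewrite (submx_trans (submxMl _ _)) ?eq_row_base.
  have [p pS yp] := hitsS yb; exists (enum_rank_in pS p).
  rewrite [RHS]mxE -yp; have := yE (enum_rank_in pS p).
  by rewrite enum_rankK_in // => ->; rewrite addrAC subrr add0r.
have [y [yb yN]] : exists y, comb y = b /\
    forall p, p \in S -> p != enum_val j -> y p != u.
  apply: contrapT => ny; apply: (minS (enum_valP j)) => y yb.
  apply: contrapT => np; apply: ny; exists y; split=> // p pS pj.
  by apply/eqP => yp; apply: np; exists p; rewrite // !inE pj.
have : (\row_i (y (enum_val i) - y0 (enum_val i)) <= row_base (kermx N))%MS.
  by rewrite eq_row_base comb_sub_kermx.
move=> /submxP[x xE].
exists x => i ij; rewrite -xE !mxE (inj_eq (addIr _)) yN ?enum_valP //.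
by rewrite (inj_eq enum_val_inj).
Qed.

Lemma rank_kermx_bound : (#|S| + \rank (rows (~: S)) <= \rank (kermx N) + d)%N.
Proof.
have rN : (\rank N <= d - \rank (rows (~: S)))%N.
  by rewrite -mxrank_coker mxrankM_maxr.
have := rank_leq_col (rows (~: S)); have := rank_leq_row N.
by rewrite mxrank_ker; lia.
Qed.
End BasesToCovering.

(* A minimal covering subfamily S lives on the kernel of F^S -> F^d / T, where T
   is the span of the rows outside S.  With t = codim T, this kernel has
   dimension at least |S| - t, while each block contributes at least t members
   to S. *)
Lemma bases_avoid (F : fieldType) (l d : nat) (W : 'I_l.+2 -> 'M[F]_d)
    (b : 'rV[F]_d) (u : F) :
  (forall n k, (0 < n)%N -> hyperplane_covering 'rV[F]_n k ->
     (n * l.+1 <= k * l)%N) ->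
  (forall i, W i \in unitmx) ->
  exists y : 'I_l.+2 -> 'I_d -> F,
    \sum_i \sum_j y i j *: row j (W i) = b /\ forall i j, y i j != u.
Proof.
move=> bound unitW; set c := l.+2 in W unitW *.
pose P := ('I_c * 'I_d)%type.
pose comb (y : P -> F) := \sum_p y p *: row p.2 (W p.1).
pose hits (S : {set P}) := forall y, comb y = b -> exists2 p, p \in S & y p = u.
apply: contrapT => none.
have hitsT : `[< hits [set: P]%SET >].
  apply/asboolP => y yb; apply: contrapT => nu; apply: none.
  exists (fun i j => y (i, j)); split=> [|i j].
    by rewrite pair_bigA -[RHS]yb; apply: eq_bigr => -[].
  by apply/eqP => yu; apply: nu; exists (i, j).
have [S /minsetP[/asboolP hitsS minS] _] :=
  @minset_exists _ (fun S => `[< hits S >]) _ hitsT.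
have minS' p : p \in S -> ~ hits (S :\ p)%SET.
  move=> pS /asboolP /minS/(_ (finset.subsetDl _ _))/finset.setP/(_ p).
  by rewrite !inE eqxx pS.
have [y0 y0b] : exists y0, comb y0 = b.
  (* A single basis already represents [b]. *)
  pose i0 : 'I_c := ord0; pose z := b *m invmx (W i0).
  exists (fun p => if p.1 == i0 then z 0 p.2 else 0).
  rewrite /comb -(pair_bigA _ (fun i j => (if i == i0 then z 0 j else 0) *: row j (W i))) /=.
  rewrite (bigD1 i0) //= [X in _ + X]big1 => [|i /negPf ->]; last first.
    by rewrite big1 // => j _; rewrite scale0r.
  by rewrite addr0 ?eqxx -mulmx_sum_row mulmxKV.
have covM := kermx_covering_matrix y0b hitsS minS'.
have cardle := card_rows_le unitW (~: S)%SET.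
have := rank_kermx_bound W S; set n := \rank (kermx _) => rkS.
have cardP : (#|S| + #|(~: S)%SET| = c * d)%N.
  by rewrite cardsC card_prod !card_ord.
have S0 : (0 < #|S|)%N.
  by have [p pS _] := hitsS y0 y0b; apply/card_gt0P; exists p.
have nb : (n * l.+1 <= #|S| * l)%N.
  have [->|n0] := posnP n; first by [].
  exact: bound n0 (matrix_hyperplane_covering n0 covM).
have := rank_leq_col (\matrix_(i < #|(~: S)%SET|) row (enum_val i).2 (W (enum_val i).1)).
move: rkS cardle cardP S0 nb; rewrite /c; set t := \rank _.
move: #|S| #|(~: S)%SET| n t => s o n' t rkS ot so s0 nb td.
(* The rank bound and [nb] give [s <= (d - t) * l.+1]; with [sq] this forces [s] to be zero, against
   [s0]. Hence the choice of [l.+2] bases. *)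
have sq : ((d - t) * l.+2 <= s)%N by nia.
have : (s * l.+1 <= (n' + (d - t)) * l.+1)%N by rewrite leq_mul2r; lia.
by nia.
Qed.

Section VectBasesAvoid.
Import passmx.

Lemma vect_bases_avoid (F : fieldType) (V : vectType F) (l : nat)
    (B : 'I_l.+2 -> seq V) (v : V) (u : F) :
  (forall n k, (0 < n)%N -> hyperplane_covering 'rV[F]_n k ->
     (n * l.+1 <= k * l)%N) ->
  (forall i, basis_of {:V} (B i)) ->
  exists y : 'I_l.+2 -> 'I_(\dim {:V}) -> F,
    \sum_i \sum_j y i j *: (B i)`_j = v /\ forall i j, y i j != u.
Proof.
move=> bound basisB; set d := \dim _.
pose coords : {linear V -> 'rV[F]_d} := rVof (vbasis {:V}).
have coords_inj : injective coords := can_inj (rVofK (vbasisP _)).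
have sizeB i : size (B i) == d.
  by rewrite -(eqP (basis_free (basisB i))) (span_basis (basisB i)).
pose W i : 'M[F]_d := \matrix_(j < d) coords (B i)`_j.
have unitW i : W i \in unitmx.
  rewrite -row_free_unit; apply/inj_row_free => z zW.
  apply/rowP => j; rewrite mxE.
  have /freeP freeB : free (Tuple (sizeB i)) := basis_free (basisB i).
  apply: (freeB (fun j => z 0 j)).
  apply: coords_inj; rewrite linear0 -[RHS]zW mulmx_sum_row linear_sum.
  by apply: eq_bigr => {}j _; rewrite linearZ rowK.
have [y [yv yN]] := bases_avoid (coords v) u bound unitW.
exists y; split=> //; apply: coords_inj; rewrite -yv linear_sum.
apply: eq_bigr => i _; rewrite linear_sum; apply: eq_bigr => j _.
by rewrite linearZ rowK.
Qed.

End VectBasesAvoid.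

Lemma additive_basis_bound_coverings (l : nat) :
  (forall n k, (0 < n)%N -> hyperplane_covering 'rV['F_3]_n k ->
     (n * l.+1 <= k * l)%N) ->
  additive_basis_bound l.+2.
Proof.
move=> bound V B basisB v.
have BE i : B i = [seq (B i)`_(val j) | j <- enum 'I_(\dim {:V})].
  rewrite (map_comp (fun j => (B i)`_j) val) val_enum_ord.
  rewrite -(span_basis (basisB i)) (eqP (basis_free (basisB i))).
  exact/esym/mkseq_nth.
(* Avoiding the value -1 in GF(3) leaves the coefficients 0 and 1. *)
have [y [<- yN]] := vect_bases_avoid v (-1) bound basisB.
rewrite (eq_map BE); apply/zero_one_comb_flatten => [i|]; first exact: enum_uniq.
exists (fun i j => y i j == 1).
apply: eq_bigr => i _; rewrite big_enum; apply: eq_bigr => j _; congr (_ *: _).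
have [] := @F3_neq0 (1 + y i j); first by rewrite addrC addr_eq0 yN.
by move=> e /addrI ->; case: e.
Qed.

(** * The infimum and the equivalence *)

(** For positive [l], the inequality is [k / n >= 1 + 1 / l] cleared of denominators. *)
Lemma epsilon_gt0P (R : realType) (F : finFieldType) :
  0 < epsilon R F <->
  exists l : nat, forall n k, (0 < n)%N -> hyperplane_covering 'rV[F]_n k ->
    (n * l.+1 <= k * l)%N.
Proof.
rewrite /epsilon; set E := [set r : R | _]%classic.
have E1 : E ((lq F (ltn0Sn 0))%:R / 1%:R) by exists 1, (ltn0Sn 0).
split=> [eps_gt0|[l bound]].
  set eps := inf E - 1 in eps_gt0.
  have infE : inf E = 1 + eps by rewrite addrC subrK.
  clearbody eps.
  have lbE : has_lbound E.
    by exists 0 => _ [n [n_gt0 ->]]; rewrite divr_ge0.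
  pose l := Num.bound eps^-1; exists l => n k n_gt0 covk.
  have lqk : (lq F n_gt0 <= k)%N.
    by rewrite /lq; case: ex_minnP => k' _; apply; apply/asboolP.
  have n0 : 0 < n%:R :> R by rewrite ltr0n.
  have infk : 1 + eps <= k%:R / n%:R.
    rewrite -infE.
    have En : E ((lq F n_gt0)%:R / n%:R) by exists n, n_gt0.
    apply: le_trans (ge_inf lbE En) _.
    by rewrite ler_wpM2r ?invr_ge0 ?(ltW n0) // ler_nat.
  have lE : 1 <= eps * l%:R.
    rewrite mulrC -ler_pdivrMr // div1r ltW // archi_boundP //.
    by rewrite invr_ge0 ltW.
  rewrite ler_pdivlMr // in infk.
  rewrite -(ler_nat R) !natrM; apply: le_trans (ler_wpM2r (ler0n _ _) infk).
  rewrite -natr1 mulrDr mulr1 !mulrDl mul1r lerD2l mulrAC.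
  exact: ler_peMl (ltW n0) lE.
(* Using [l.+1] instead of [l] weakens the bound but stays meaningful when [l] is zero. *)
have lbE : lbound E (1 + l.+1%:R^-1).
  move=> _ [n [n_gt0 ->]]; rewrite ler_pdivlMr ?ltr0n //.
  have /(bound n _ n_gt0) nk : hyperplane_covering 'rV[F]_n (lq F n_gt0).
    by rewrite /lq; case: ex_minnP => k /asboolP.
  rewrite -(ler_pM2r (_ : 0 < l.+1%:R)) ?ltr0n // mulrAC mulrDl mul1r.
  rewrite mulVf ?pnatr_eq0 // natr1 -!natrM ler_nat.
  nia.
rewrite subr_gt0; apply: lt_le_trans (lb_le_inf (ex_intro _ _ E1) lbE).
by rewrite ltrDl invr_gt0 ltr0n.
Qed.

Theorem mainTheorem7 (R : realType) :
  0 < epsilon R 'F_3 <->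
  exists c : nat,
    forall (V : vectType 'F_3) (B : 'I_c -> seq V),
      (forall i, basis_of {:V} (B i)) ->
      forall v : V, zero_one_comb (flatten [seq B i | i <- enum 'I_c]) v.
Proof.
apply: iff_trans (epsilon_gt0P R 'F_3) _; split=> [[l bound]|[c bound]].
  by exists l.+2; exact: additive_basis_bound_coverings.
exists c => n k n_gt0 /hyperplane_covering_matrix[A [a covA]].
have lek := covering_matrix_size bound covA.
(* This makes [k - n] a true difference, so [c * n + n <= c * n + k <= c * k]. *)
have len : (n <= k)%N by case: covA => /eqP rA _ _; rewrite -rA rank_leq_col.
by nia.
Qed.
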